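(* Let $\mathcal{C}$ be a category with pairwise coproducts, let $k$ be a commutative ring, and let $\mathcal{F}:\mathcal{C}\to \mathsf{Mod}(k)$ be a monoadditive representation of $\mathcal{C}$. Then for any $n\geq 0$ there is an isomorphism $$\varprojlim{}^{n}\,\mathcal{F}\;\cong\;\varprojlim{}^{n-1}\,\Sigma\mathcal{F}.$$
   Context: Conventions: all categories are assumed small with respect to an appropriate Grothendieck universe. A representation of a category $\mathcal{C}$ over a commutative ring $k$ is a functor $\mathcal{F}:\mathcal{C}\to\mathsf{Mod}(k)$. The limit functor $\varprojlim:\mathsf{Mod}(k)^{\mathcal{C}}\to\mathsf{Mod}(k)$ is left exact, and $\varprojlim^{n}$ denotes its $n$-th right derived functor (with $\varprojlim^{n}=0$ for $n<0$). $\mathcal{C}$ has pairwise coproducts if for any objects $c_1,c_2$ a coproduct $c_1\xrightarrow{i_1}c_1\sqcup c_2\xleftarrow{i_2}c_2$ exists in $\mathcal{C}$ (an initial object is not required). For a representation $\mathcal{F}$ of such $\mathcal{C}$ put $\mathcal{F}_{\mathsf{sq}}(c)=\mathcal{F}(c\sqcup c)$ and let $\mathsf{T}_{\mathcal{F}}:\mathcal{F}\oplus\mathcal{F}\to\mathcal{F}_{\mathsf{sq}}$ be the natural transformation $\mathsf{T}_{\mathcal{F},c}=(\mathcal{F}(i_1),\mathcal{F}(i_2)):\mathcal{F}(c)\oplus\mathcal{F}(c)\to\mathcal{F}(c\sqcup c)$. $\mathcal{F}$ is called monoadditive if $\mathsf{T}_{\mathcal{F}}$ is a monomorphism. $\Sigma\mathcal{F}:=\mathrm{coker}(\mathsf{T}_{\mathcal{F}})$.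 *)

(* Defs.v *)
From HB Require Import structures.
From mathcomp Require Import all_boot all_order all_algebra.
From mathcomp Require Import boolp classical_sets.

Set Implicit Arguments.
Unset Strict Implicit.
Unset Printing Implicit Defensive.

Import Order.TTheory GRing.Theory Num.Theory.
Local Open Scope ring_scope.
Local Open Scope quotient_scope.
Local Open Scope classical_set_scope.

Section MkLinear.
Variables (k : pzRingType) (U V : lmodType k) (f : U -> V) (f_lin : linear f).

Definition mk_linear : {linear U -> V} :=
  HB.pack f (GRing.isLinear.Build k U V *:%R f f_lin).

Lemma mk_linearE x : mk_linear x = f x. Proof. by []. Qed.
End MkLinear.

Definition mk_additive (A B : zmodType) (f : A -> B) (f_add : zmod_morphism f) :
  {additive A -> B} := HB.pack f (GRing.isZmodMorphism.Build A B f f_add).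

Definition lmod_iso (k : pzRingType) (U V : lmodType k) : Prop :=
  exists f : {linear U -> V}, bijective f.

Record submodule (k : pzRingType) (V : lmodType k) := Submodule {
  submem :> V -> Prop;
  submem0 : submem 0;
  submemZD : forall a u v, submem u -> submem v -> submem (a *: u + v)
}.

Section SubQuotient.
Variables (k : pzRingType) (V : lmodType k) (S : submodule V).

Definition subpred : V -> bool := fun x => `[< S x >].

Lemma subpred_closed : GRing.submod_closed subpred.
Proof.
split; first by apply/asboolP; exact: submem0.
by move=> a u v /asboolP Su /asboolP Sv; apply/asboolP; exact: submemZD.
Qed.

HB.instance Definition _ :=
  GRing.isSubmodClosed.Build k V subpred subpred_closed.

Definition submod := {x : V | subpred x}.
HB.instance Definition _ := SubChoice.on submod.
HB.instance Definition _ := [SubChoice_isSubLmodule of submod by <:].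

Lemma submodP (x : submod) : S (val x).
Proof. exact/asboolP/(valP x). Qed.

Definition mk_submod (x : V) (Sx : S x) : submod := Sub x (asboolT Sx).

Definition quotmod : Type :=
  Quotient.quot (GRing.ZmodClosed.clone V subpred _).
HB.instance Definition _ := GRing.Zmodule.on quotmod.

Definition qpi_fun (x : V) : quotmod := \pi_quotmod x.

Lemma qpi_eq x y : qpi_fun x = qpi_fun y <-> S (x - y).
Proof.
split=> [/eqP|Sxy]; last apply/eqP.
  by rewrite /qpi_fun -Quotient.idealrBE => /asboolP.
by rewrite /qpi_fun -Quotient.idealrBE; apply/asboolP.
Qed.

Lemma qpi_repr x : qpi_fun (repr x) = x. Proof. exact: reprK. Qed.

Lemma qpiD x y : qpi_fun (x + y) = qpi_fun x + qpi_fun y.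
Proof. exact: (Quotient.pi_add _ x y). Qed.

Definition quotscale a (x : quotmod) : quotmod := qpi_fun (a *: repr x).

Lemma qpiZ a x : qpi_fun (a *: x) = quotscale a (qpi_fun x).
Proof.
apply/qpi_eq; rewrite -scalerBr -[_ *: _]addr0.
by apply: submemZD; [apply/qpi_eq; rewrite qpi_repr|exact: submem0].
Qed.

Lemma quotscaleA a b x : quotscale a (quotscale b x) = quotscale (a * b) x.
Proof. by rewrite -(qpi_repr x) -!qpiZ scalerA. Qed.
Lemma quotscale1 : left_id 1 quotscale.
Proof. by move=> x; rewrite -(qpi_repr x) -!qpiZ scale1r. Qed.
Lemma quotscaleDr : right_distributive quotscale +%R.
Proof.
move=> a x y; rewrite -(qpi_repr x) -(qpi_repr y).
by rewrite -!(qpiD, qpiZ) scalerDr.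
Qed.
Lemma quotscaleDl x : {morph quotscale^~ x : a b / a + b}.
Proof. by move=> a b; rewrite -(qpi_repr x) -!qpiZ scalerDl qpiD. Qed.

HB.instance Definition _ := GRing.Zmodule_isLmodule.Build k quotmod
  quotscaleA quotscale1 quotscaleDr quotscaleDl.

Lemma qpi_linear : linear qpi_fun.
Proof. by move=> a x y; rewrite qpiD qpiZ. Qed.

Definition qpi : {linear V -> quotmod} := mk_linear qpi_linear.

Lemma qpi_surj x : exists y, qpi y = x.
Proof. by exists (repr x); exact: qpi_repr. Qed.

Lemma qpi_eq0 x : qpi x = 0 <-> S x.
Proof.
by rewrite -[X in S X]subr0 -qpi_eq -[qpi_fun 0]/(qpi 0) raddf0.
Qed.

Section Lift.
Variables (W : lmodType k) (f : {linear V -> W}).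
Hypothesis f0 : forall x, S x -> f x = 0.

Definition qlift_fun (x : quotmod) : W := f (repr x).

Lemma qlift_funE x : qlift_fun (qpi x) = f x.
Proof.
apply/eqP; rewrite -subr_eq0 -raddfB; apply/eqP/f0.
by apply/qpi_eq; rewrite qpi_repr.
Qed.

Lemma qlift_linear : linear qlift_fun.
Proof.
move=> a x y; have [u <-] := qpi_surj x; have [v <-] := qpi_surj y.
by rewrite -linearP !qlift_funE linearP.
Qed.

Definition qlift : {linear quotmod -> W} := mk_linear qlift_linear.
Lemma qliftE x : qlift (qpi x) = f x. Proof. exact: qlift_funE. Qed.
End Lift.
End SubQuotient.
Arguments qpi : simpl never.
Arguments qlift : simpl never.

Definition dprod (I : Type) (k : pzRingType) (V : I -> lmodType k) : Type :=
  forall i, V i.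

Section Product.
Variables (I : Type) (k : pzRingType) (V : I -> lmodType k).

HB.instance Definition _ := gen_eqMixin (dprod V).
HB.instance Definition _ := gen_choiceMixin (dprod V).

Let add (x y : dprod V) : dprod V := fun i => x i + y i.
Let opp (x : dprod V) : dprod V := fun i => - x i.
Let zero : dprod V := fun i => 0.
Let scale a (x : dprod V) : dprod V := fun i => a *: x i.

Fact dprod_addA : associative add.
Proof. by move=> x y z; apply: functional_extensionality_dep => i; exact: addrA. Qed.
Fact dprod_addC : commutative add.
Proof. by move=> x y; apply: functional_extensionality_dep => i; exact: addrC. Qed.
Fact dprod_add0 : left_id zero add.
Proof. by move=> x; apply: functional_extensionality_dep => i; exact: add0r. Qed.
Fact dprod_addN : left_inverse zero opp add.
Proof. by move=> x; apply: functional_extensionality_dep => i; exact: addNr. Qed.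
HB.instance Definition _ := GRing.isZmodule.Build (dprod V)
  dprod_addA dprod_addC dprod_add0 dprod_addN.

Fact dprod_scaleA a b x : scale a (scale b x) = scale (a * b) x.
Proof. by apply: functional_extensionality_dep => i; exact: scalerA. Qed.
Fact dprod_scale1 : left_id 1 scale.
Proof. by move=> x; apply: functional_extensionality_dep => i; exact: scale1r. Qed.
Fact dprod_scaleDr : right_distributive scale +%R.
Proof. by move=> a x y; apply: functional_extensionality_dep => i; exact: scalerDr. Qed.
Fact dprod_scaleDl x : {morph scale^~ x : a b / a + b}.
Proof. by move=> a b; apply: functional_extensionality_dep => i; exact: scalerDl. Qed.
HB.instance Definition _ := GRing.Zmodule_isLmodule.Build k (dprod V)
  dprod_scaleA dprod_scale1 dprod_scaleDr dprod_scaleDl.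

Lemma dprodD (x y : dprod V) i : (x + y) i = x i + y i. Proof. by []. Qed.
Lemma dprod0 i : (0 : dprod V) i = 0. Proof. by []. Qed.
Lemma dprodZ a (x : dprod V) i : (a *: x) i = a *: x i. Proof. by []. Qed.
End Product.

(* Hom_Z(k, A), with the k-module structure (r g)(a) = g(a r) *)
Section CoInduced.
Variables (k : pzRingType) (A : zmodType).

Record coind : Type := Coind {
  coind_fun :> k -> A;
  coindD : {morph coind_fun : a b / a + b}
}.

Lemma coindP (g h : coind) : (forall a, g a = h a) -> g = h.
Proof.
case: g h => g gD [h hD] /= /funext gh.
by case: h / gh hD => hD; congr Coind; exact: Prop_irrelevance.
Qed.

HB.instance Definition _ := gen_eqMixin coind.
HB.instance Definition _ := gen_choiceMixin coind.

Program Definition coind_add (g h : coind) := @Coind (fun a => g a + h a) _.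
Next Obligation. by move=> a b; rewrite !coindD addrACA. Qed.
Program Definition coind_opp (g : coind) := @Coind (fun a => - g a) _.
Next Obligation. by move=> a b; rewrite coindD opprD. Qed.
Program Definition coind_zero := @Coind (fun a => 0) _.
Next Obligation. by move=> a b; rewrite addr0. Qed.
Program Definition coind_scale r (g : coind) := @Coind (fun a => g (a * r)) _.
Next Obligation. by move=> a b; rewrite mulrDl coindD. Qed.

Fact coind_addA : associative coind_add.
Proof. by move=> x y z; apply: coindP => a; exact: addrA. Qed.
Fact coind_addC : commutative coind_add.
Proof. by move=> x y; apply: coindP => a; exact: addrC. Qed.
Fact coind_add0 : left_id coind_zero coind_add.
Proof. by move=> x; apply: coindP => a; exact: add0r. Qed.
Fact coind_addN : left_inverse coind_zero coind_opp coind_add.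
Proof. by move=> x; apply: coindP => a; exact: addNr. Qed.
HB.instance Definition _ := GRing.isZmodule.Build coind
  coind_addA coind_addC coind_add0 coind_addN.

Fact coind_scaleA a b x : coind_scale a (coind_scale b x) = coind_scale (a * b) x.
Proof. by apply: coindP => c /=; rewrite mulrA. Qed.
Fact coind_scale1 : left_id 1 coind_scale.
Proof. by move=> x; apply: coindP => a /=; rewrite mulr1. Qed.
Fact coind_scaleDr : right_distributive coind_scale +%R.
Proof. by move=> a x y; apply: coindP. Qed.
Fact coind_scaleDl x : {morph coind_scale^~ x : a b / a + b}.
Proof. by move=> a b; apply: coindP => c /=; rewrite mulrDr coindD. Qed.
HB.instance Definition _ := GRing.Zmodule_isLmodule.Build k coind
  coind_scaleA coind_scale1 coind_scaleDr coind_scaleDl.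
End CoInduced.

Definition intrat : rat -> bool := fun x => x \is a Num.int.
Lemma intrat_closed : zmod_closed intrat.
Proof. by split=> [|x y]; [exact: rpred0|exact: rpredB]. Qed.
HB.instance Definition _ := GRing.isZmodClosed.Build rat intrat intrat_closed.

Definition QZ : zmodType := Quotient.quot (GRing.ZmodClosed.clone rat intrat _).

(* Baer: additive maps into a divisible group extend along injective ones *)
Section Divisible.
Variable D : zmodType.
Hypothesis D_div : forall (n : nat) (y : D), (0 < n)%N -> exists x, x *+ n = y.
Variables (A B : zmodType) (m : {additive A -> B}) (f : {additive A -> D}).
Hypothesis kerm : forall a, m a = 0 -> f a = 0.

Let graph : set (B * D) := [set p | exists a, p = (m a, f a)].
Let P (G : set (B * D)) : Prop :=
  [/\ (exists p, G p) -> graph `<=` G,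
      forall p q, G p -> G q -> G (p - q) &
      forall d, G (0, d) -> d = 0].

Lemma divisible_injective : exists g : {additive B -> D}, forall a, g (m a) = f a.
Proof.
have [F FP Ftot|G [[Gne Gsub G0] Gmax]] := @Zorn_bigcup _ P.
  split.
  - move=> [p [X FX Xp]] q gq; exists X => //.
    by have [+ _ _] := FP _ FX; apply=> //; exists p.
  - move=> p q [X FX Xp] [Y FY Yq].
    have [XY|YX] := Ftot _ _ FX FY.
      by exists Y => //; have [_ + _] := FP _ FY; apply=> //; exact: XY.
    by exists X => //; have [_ + _] := FP _ FX; apply=> //; exact: YX.
  - by move=> d [X FX X0]; have [_ _] := FP _ FX; apply.
have Pgraph : P graph.
  split; first by move=> _ p gp.
  - by move=> _ _ [a ->] [a' ->]; exists (a - a'); rewrite !raddfB.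
  - by move=> d [a [/esym/kerm + ->]].
have graphG : graph `<=` G.
  apply: Gne; apply: contrapT => nG; apply: (Gmax graph _ Pgraph); split.
    by move=> p Gp; case: nG; exists p.
  by move=> sub; apply: nG; exists (m 0, f 0); apply: sub; exists 0.
have G00 : G 0 by apply: graphG; exists 0; rewrite !raddf0.
have GN p : G p -> G (- p) by move=> Gp; rewrite -sub0r; exact: Gsub.
have GD p q : G p -> G q -> G (p + q).
  by move=> Gp Gq; rewrite -[q]opprK; apply: Gsub => //; exact: GN.
have GMn p n : G p -> G (p *+ n).
  by move=> Gp; elim: n => [|n IH]; rewrite ?mulr0n ?mulrS //; exact: GD.
have GMz p (z : int) : G p -> G (p *~ z).
  by case: z => n Gp; [exact: GMn|exact/GN/GMn].
have Gfun b d d' : G (b, d) -> G (b, d') -> d = d'.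
  move=> Gd Gd'; apply/eqP; rewrite -subr_eq0; apply/eqP/G0.
  by have := Gsub _ _ Gd Gd'; rewrite -[_ - _]/(b - b, d - d') subrr.
have mulp (b : B) (d : D) (z : int) : (b, d) *~ z = (b *~ z, d *~ z).
  have mulpn n : (b, d) *+ n = (b *+ n, d *+ n).
    by elim: n => // n IH; rewrite !mulrS IH.
  by case: z => n; [exact: mulpn|exact: (congr1 -%R (mulpn n.+1))].
have dom b : exists d, G (b, d).
  apply: contrapT => nb.
  have [d dP] : exists d, forall (z : int) v, G (b *~ z, v) -> v = d *~ z.
    pose Q n := (0 < n)%N && `[< exists y, G (b *+ n, y) >].
    have [[n0 Qn0]|nQ] := pselect (exists n, Q n); last first.
      exists 0 => z v Gv; rewrite mul0rz.
      have z0 : z = 0.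
        apply: contrapT => /eqP z0; apply: nQ; exists `|z|%N.
        rewrite /Q absz_gt0 z0; apply/asboolP.
        case: z Gv z0 => n Gv _; first by exists v.
        by exists (- v); have := GN _ Gv; rewrite -[- _]/(- (b *~ _), - v) opprK.
      by apply: G0; rewrite -[0](mulr0z b) -z0.
    have exQ : exists n, Q n by exists n0.
    have [n /andP[n_gt0 /asboolP[y Gy]] nmin] := ex_minnP exQ.
    have [d dn] := D_div y n_gt0.
    exists d => z v Gv.
    have zE := divz_eq z n; set q := (z %/ n)%Z in zE; set r := (z %% n)%Z in zE.
    have : r < n by rewrite ltz_pmod.
    have : 0 <= r by rewrite modz_ge0 // eqz_nat -lt0n.
    have Gr : G (b *~ r, v - y *~ q).
      have := Gsub _ _ Gv (GMz _ q Gy).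
      rewrite mulp -[_ - _]/(b *~ z - _, v - _) {1}zE mulrzDr.
      by rewrite [q * n]mulrC mulrzA -pmulrn addrAC subrr add0r.
    case: r zE Gr => // r zE Gr _ rn.
    have r0 : r = 0%N.
      apply/eqP; rewrite -leqn0 leqNgt; apply/negP => r_gt0.
      have : (n <= r)%N by apply: nmin; rewrite /Q r_gt0; apply/asboolP; exists (v - y *~ q).
      by rewrite leqNgt -ltz_nat rn.
    move: Gr; rewrite r0 => /G0/eqP; rewrite subr_eq0 => /eqP ->.
    by rewrite zE r0 addr0 mulrC mulrzA -pmulrn dn.
  pose G' : set (B * D) := [set p | exists2 q, G q & exists z : int, p = q + (b, d) *~ z].
  apply: (Gmax G').
    split=> [p Gp|sub]; first by exists p => //; exists 0; rewrite mulr0z addr0.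
    apply: nb; exists d; apply: sub; exists 0 => //.
    by exists 1; rewrite add0r.
  split.
  - by move=> _ p gp; exists p; [exact: graphG|exists 0; rewrite mulr0z addr0].
  - move=> _ _ [p Gp [z ->]] [q Gq [t ->]]; exists (p - q); first exact: Gsub.
    by exists (z - t); rewrite mulrzBr opprD addrACA.
  - move=> e [[u v] Guv [z]]; rewrite mulp => -[/esym/eqP].
    rewrite addrC addr_eq0 => /eqP bz ->.
    have := GN _ Guv; rewrite -[- _]/(- u, - v) -bz => /dP vE.
    by rewrite -vE addrN.
have [g gP] := choice dom.
have g_add : zmod_morphism g.
  move=> x y; apply: (Gfun (x - y)); first exact: gP.
  exact: (Gsub _ _ (gP x) (gP y)).
exists (mk_additive g_add) => a.
by apply: (Gfun (m a)); [exact: gP|apply: graphG; exists a].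
Qed.
End Divisible.

Lemma QZ_pi_add : zmod_morphism (fun x : rat => \pi_QZ x : QZ).
Proof.
move=> x y; apply: etrans (Quotient.pi_add _ x (- y)) _.
exact: (congr1 (fun z : QZ => \pi_QZ x + z) (Quotient.pi_opp _ y)).
Qed.
Definition QZ_pi : {additive rat -> QZ} := mk_additive QZ_pi_add.

Lemma QZ_pi_eq0 x : QZ_pi x = 0 <-> x \is a Num.int.
Proof.
have : (x - 0 \in intrat) = (QZ_pi x == QZ_pi 0).
  exact: (Quotient.idealrBE (GRing.ZmodClosed.clone rat intrat _) x 0).
rewrite subr0 raddf0 => e; split=> [/eqP|xZ]; first by rewrite -e.
by apply/eqP; rewrite -e.
Qed.

Lemma QZ_div (n : nat) (y : QZ) : (0 < n)%N -> exists x, x *+ n = y.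
Proof.
move=> n_gt0; exists (QZ_pi (repr y / n%:R)).
have n0 : n%:R != 0 :> rat by rewrite pnatr_eq0 -lt0n.
by rewrite -raddfMn -[_ *+ n]mulr_natr divfK //; exact: reprK.
Qed.

Lemma QZ_cogenerator (B : zmodType) (x : B) :
  x <> 0 -> exists g : {additive B -> QZ}, g x <> 0.
Proof.
move=> x0; pose Q n := (0 < n)%N && (x *+ n == 0).
have [n n_gt1 nP] : exists2 n : nat, (1 < n)%N &
    forall z : int, x *~ z = 0 -> (n %| z)%Z.
  have [exQ|nQ] := pselect (exists n, Q n); last first.
    exists 2%N => // z xz; suff -> : z = 0 by [].
    apply: contrapT => /eqP z0; apply: nQ; exists `|z|%N.
    rewrite /Q absz_gt0 z0; case: z xz z0 => n xz _; first exact/eqP.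
    by apply/eqP/oppr_inj; rewrite oppr0.
  have [n /andP[n_gt0 /eqP xn] nmin] := ex_minnP exQ; exists n.
    by case: n n_gt0 xn {nmin} => // -[].
  move=> z xz; apply/dvdz_mod0P.
  have zE := divz_eq z n; set q := (z %/ n)%Z in zE; set r := (z %% n)%Z in zE *.
  have : r < n by rewrite ltz_pmod.
  have : 0 <= r by rewrite modz_ge0 // eqz_nat -lt0n.
  have : x *~ r = 0.
    by move: xz; rewrite zE mulrzDr [q * n]mulrC mulrzA -pmulrn xn mul0rz add0r.
  case: r zE => // r zE xr _ rn; congr Posz.
  apply/eqP; rewrite -leqn0 leqNgt; apply/negP => r_gt0.
  have : (n <= r)%N by apply: nmin; rewrite /Q r_gt0; apply/eqP.
  by rewrite leqNgt -ltz_nat rn.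
have n0 : n%:R != 0 :> rat by rewrite pnatr_eq0 -lt0n ltnW.
have m_add : zmod_morphism (fun z : int => x *~ z) by move=> z t; exact: mulrzBr.
have f_add : zmod_morphism (fun z : int => QZ_pi (z%:~R / n%:R)).
  by move=> z t; rewrite -raddfB /= -mulrBl intrB.
have [|g gP] := @divisible_injective QZ QZ_div _ _ (mk_additive m_add) (mk_additive f_add).
  move=> z /nP/dvdzP[q ->]; apply/QZ_pi_eq0.
  by rewrite intrM -pmulrn mulfK.
exists g; have := gP 1 => /= ->; move=> /QZ_pi_eq0.
rewrite mul1r => /intrP[z zE].
have : (z * n)%:~R = 1%:~R :> rat by rewrite intrM -zE -pmulrn mulVf.
move=> /eqP; rewrite eqr_int => /eqP zn1.
have : (n %| 1)%Z by apply/dvdzP; exists z.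
by rewrite dvdz1 /= => /eqP n1; rewrite n1 in n_gt1.
Qed.

Local Obligation Tactic := idtac.

Record category := Category {
  ob :> Type;
  hom : ob -> ob -> Type;
  idc : forall a, hom a a;
  comp : forall a b c, hom b c -> hom a b -> hom a c;
  comp1c : forall a b (f : hom a b), comp (idc b) f = f;
  compc1 : forall a b (f : hom a b), comp f (idc a) = f;
  compcA : forall a b c d (h : hom c d) (g : hom b c) (f : hom a b),
    comp h (comp g f) = comp (comp h g) f
}.
Arguments idc {c0} a.

(* a choice of a coproduct for every pair of objects; no initial object *)
Record pairwise_coproducts (C : category) := PairwiseCoproducts {
  cop : C -> C -> C;
  in1 : forall a b, hom a (cop a b);
  in2 : forall a b, hom b (cop a b);
  copair : forall a b d, hom a d -> hom b d -> hom (cop a b) d;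
  copair1 : forall a b d (f : hom a d) (g : hom b d),
    comp (copair f g) (in1 a b) = f;
  copair2 : forall a b d (f : hom a d) (g : hom b d),
    comp (copair f g) (in2 a b) = g;
  copair_uniq : forall a b d (f : hom a d) (g : hom b d) (h : hom (cop a b) d),
    comp h (in1 a b) = f -> comp h (in2 a b) = g -> h = copair f g
}.

Section Coproduct.
Variables (C : category) (cp : pairwise_coproducts C).

Definition cop_map (a b a' b' : C) (f : hom a a') (g : hom b b') :
    hom (cop cp a b) (cop cp a' b') :=
  copair cp (comp (in1 cp a' b') f) (comp (in2 cp a' b') g).

Lemma cop_map1 (a b : C) : cop_map (idc a) (idc b) = idc (cop cp a b).
Proof. by apply/esym/copair_uniq; rewrite comp1c compc1. Qed.

Lemma cop_mapM (a b a' b' a'' b'' : C) (f' : hom a' a'') (f : hom a a')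
    (g' : hom b' b'') (g : hom b b') :
  cop_map (comp f' f) (comp g' g) = comp (cop_map f' g') (cop_map f g).
Proof.
apply/esym/copair_uniq; rewrite -compcA.
  by rewrite copair1 compcA copair1 compcA.
by rewrite copair2 compcA copair2 compcA.
Qed.
End Coproduct.

Section Representations.
Variables (k : comPzRingType) (C : category).

Record rep := Rep {
  rep_ob :> C -> lmodType k;
  rep_map : forall a b, hom a b -> {linear rep_ob a -> rep_ob b};
  rep_map1 : forall a x, rep_map (idc a) x = x;
  rep_mapM : forall a b c (g : hom b c) (f : hom a b) x,
    rep_map (comp g f) x = rep_map g (rep_map f x)
}.

Record rep_hom (F G : rep) := RepHom {
  rep_hom_at :> forall c, {linear F c -> G c};
  rep_hom_nat : forall a b (f : hom a b) x,
    rep_hom_at b (rep_map F f x) = rep_map G f (rep_hom_at a x)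
}.

Program Definition rep_comp (F G H : rep) (v : rep_hom G H) (u : rep_hom F G) :
  rep_hom F H := @RepHom F H (fun c => v c \o u c) _.
Next Obligation. by move=> F G H v u a b f x /=; rewrite !rep_hom_nat. Qed.

(* monomorphism of the functor category; pointwise form in rep_monoP below *)
Definition rep_mono (F G : rep) (u : rep_hom F G) : Prop :=
  forall (H : rep) (v w : rep_hom H F),
    (forall c, rep_comp u v c =1 rep_comp u w c) -> forall c, v c =1 w c.

Definition rep_injective (I : rep) : Prop :=
  forall (A B : rep) (m : rep_hom A B) (u : rep_hom A I), rep_mono m ->
  exists v : rep_hom B I, forall c, rep_comp v m c =1 u c.

Program Definition ker_sub (U V : lmodType k) (f : {linear U -> V}) :=
  @Submodule k U (fun x => f x = 0) _ _.
Next Obligation. by move=> U V f; exact: raddf0. Qed.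
Next Obligation.
by move=> U V f a u v /= fu fv; rewrite linearP fu fv scaler0 addr0.
Qed.

Program Definition im_sub (U V : lmodType k) (f : {linear U -> V}) :=
  @Submodule k V (fun y => exists x, f x = y) _ _.
Next Obligation. by move=> U V f; exists 0; exact: raddf0. Qed.
Next Obligation.
by move=> U V f a _ _ [x <-] [y <-]; exists (a *: x + y); rewrite linearP.
Qed.

Section Kernel.
Variables (F G : rep) (u : rep_hom F G).
Let K c := submod (ker_sub (u c)).

Lemma krep_mapP a b (f : hom a b) (x : K a) :
  ker_sub (u b) (rep_map F f (val x)).
Proof. by rewrite /= rep_hom_nat (submodP x) raddf0. Qed.

Lemma krep_map_linear a b (f : hom a b) :
  linear (fun x : K a => mk_submod (krep_mapP f x)).
Proof. by move=> r x y; apply: val_inj; rewrite /= !linearP. Qed.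

Program Definition krep : rep :=
  @Rep (fun c => K c) (fun a b f => mk_linear (@krep_map_linear a b f)) _ _.
Next Obligation. by move=> a x; apply: val_inj; rewrite /= rep_map1. Qed.
Next Obligation.
by move=> a b c g f x; apply: val_inj; rewrite /= rep_mapM.
Qed.

Lemma krep_val_linear c : linear (fun x : K c => val x).
Proof. by []. Qed.

Program Definition krep_val : rep_hom krep F :=
  @RepHom krep F (fun c => mk_linear (@krep_val_linear c)) _.
Next Obligation. by []. Qed.

Lemma zero_hom_linear c : linear (fun _ : K c => 0 : F c).
Proof. by move=> r x y; rewrite scaler0 addr0. Qed.

Program Definition krep_zero : rep_hom krep F :=
  @RepHom krep F (fun c => mk_linear (@zero_hom_linear c)) _.
Next Obligation. by move=> a b f x /=; rewrite raddf0. Qed.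

Lemma rep_monoP : rep_mono u <-> forall c, injective (u c).
Proof.
split=> [um c x y uxy|uinj H v w vw c x]; last exact: uinj (vw c x).
have xyK : ker_sub (u c) (x - y).
  by apply: etrans (raddfB (u c) x y) _; apply/eqP; rewrite subr_eq0; apply/eqP.
have := um krep krep_val krep_zero.
move=> /(_ _ c (mk_submod xyK)) /= /(_ _)/eqP; rewrite subr_eq0 => xy.
apply/eqP/xy => d z /=; rewrite raddf0; exact: submodP z.
Qed.
End Kernel.

Section Cokernel.
Variables (F G : rep) (u : rep_hom F G).
Let Q c := quotmod (im_sub (u c)).

Lemma crep_mapP a b (f : hom a b) (x : G a) :
  im_sub (u a) x -> (qpi (im_sub (u b)) \o rep_map G f) x = 0.
Proof.
move=> [y <-]; apply/qpi_eq0; rewrite -rep_hom_nat.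
by exists (rep_map F f y).
Qed.

Program Definition crep : rep :=
  @Rep (fun c => Q c) (fun a b f => qlift (@crep_mapP a b f)) _ _.
Next Obligation.
by move=> a x; have [y <-] := qpi_surj x; rewrite qliftE /= rep_map1.
Qed.
Next Obligation.
move=> a b c g f x; have [y <-] := qpi_surj x; rewrite [LHS]qliftE.
rewrite [X in qlift _ X]qliftE.
have e := qliftE (@crep_mapP _ _ g) (rep_map G f y); apply: (etrans _ (esym e)).
by congr (qpi _ _); exact: rep_mapM.
Qed.

Program Definition crep_pi : rep_hom G crep :=
  @RepHom G crep (fun c => qpi (im_sub (u c))) _.
Next Obligation. by move=> a b f x; have /esym := qliftE (@crep_mapP _ _ f) x. Qed.
End Cokernel.

Section Limit.
Variable F : rep.

Program Definition lim_sub := @Submodule k (dprod F)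
  (fun x => forall a b (f : hom a b), rep_map F f (x a) = x b) _ _.
Next Obligation. by move=> a b f; exact: raddf0. Qed.
Next Obligation.
by move=> r x y /= xP yP a b f; rewrite !dprodD !dprodZ linearP xP yP.
Qed.

Definition lim : lmodType k := submod lim_sub.
End Limit.

Section LimitMap.
Variables (F G : rep) (u : rep_hom F G).

Lemma lim_mapP (x : lim F) : lim_sub G (fun c => u c (val x c)).
Proof. by move=> a b f; rewrite -rep_hom_nat (submodP x). Qed.

Lemma lim_map_linear : linear (fun x => mk_submod (lim_mapP x) : lim G).
Proof.
move=> r x y; apply: val_inj; apply: functional_extensionality_dep => c.
exact: linearP.
Qed.

Definition lim_map : {linear lim F -> lim G} := mk_linear lim_map_linear.
End LimitMap.

Section Cohomology.
Variables (X : nat -> lmodType k) (d : forall n, {linear X n -> X n.+1}).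

(* the complex starts in degree 0, so that its 0-coboundaries are 0 *)
Definition coboundary n : X n -> Prop :=
  match n with
  | 0 => fun x => x = 0
  | m.+1 => fun x => exists y, d m y = x
  end.

Program Definition coboundary_sub n := @Submodule k (submod (ker_sub (d n)))
  (fun x => coboundary (val x)) _ _.
Next Obligation. by case=> //= n; exists 0; rewrite raddf0. Qed.
Next Obligation.
move=> [|n] a u v /=; first by move=> -> ->; rewrite scaler0 addr0.
move=> [x xu] [y yv]; by exists (a *: x + y); rewrite linearP xu yv.
Qed.

Definition cohomology n : lmodType k := quotmod (coboundary_sub n).
End Cohomology.

Record injective_resolution (F : rep) := InjectiveResolution {
  ires :> nat -> rep;
  ires_inj : forall n, rep_injective (ires n);
  ires_d : forall n, rep_hom (ires n) (ires n.+1);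
  ires_aug : rep_hom F (ires 0);
  ires_aug_mono : rep_mono ires_aug;
  ires_exact0 : forall c y, ires_d 0 c y = 0 <-> exists x, ires_aug c x = y;
  ires_exactS : forall n c y,
    ires_d n.+1 c y = 0 <-> exists x, ires_d n c x = y
}.

(* Mod(k)^C has enough injectives: F embeds into the injective representation *)
(* sending c to the product of copies of Hom_Z(k, Q/Z) indexed by all objects *)
(* d, additive maps F(d) -> Q/Z and morphisms c -> d.                         *)
Section Embedding.
Variable F : rep.

Definition Eidx c := {d : C & ({additive F d -> QZ} * hom c d)%type}.
Let E c := dprod (fun _ : Eidx c => coind k QZ).

Definition Eidx_map a b (f : hom a b) (i : Eidx b) : Eidx a :=
  existT _ (tag i) ((tagged i).1, comp (tagged i).2 f).

Lemma Emap_linear a b (f : hom a b) :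
  linear (fun (x : E a) => (fun i => x (Eidx_map f i)) : E b).
Proof. by []. Qed.

Program Definition Erep : rep :=
  @Rep (fun c => E c) (fun a b f => mk_linear (@Emap_linear a b f)) _ _.
Next Obligation.
move=> a x; apply: functional_extensionality_dep => -[d [phi f]].
by rewrite /Eidx_map /= compc1.
Qed.
Next Obligation.
move=> a b c g f x; apply: functional_extensionality_dep => -[d [phi h]].
by rewrite /Eidx_map /= compcA.
Qed.

Lemma Erep_aug_additive c (i : Eidx c) (x : F c) :
  {morph (fun a => (tagged i).1 (a *: rep_map F (tagged i).2 x)) : a b / a + b}.
Proof. by move=> a b; rewrite scalerDl raddfD. Qed.

Lemma Erep_aug_linear c :
  linear (fun x : F c => (fun i => Coind (Erep_aug_additive i x)) : Erep c).
Proof.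
move=> r x y; apply: functional_extensionality_dep => i; apply: coindP => a.
by rewrite dprodD dprodZ /= linearP scalerDr raddfD scalerA.
Qed.

Program Definition Erep_aug : rep_hom F Erep :=
  @RepHom F Erep (fun c => mk_linear (@Erep_aug_linear c)) _.
Next Obligation.
move=> a b f x; apply: functional_extensionality_dep => i; apply: coindP => r.
by rewrite /= rep_mapM.
Qed.

Lemma Erep_aug_mono : rep_mono Erep_aug.
Proof.
apply/rep_monoP => c; apply: raddf_inj => x ux.
apply: contrapT => /QZ_cogenerator[g gx]; apply: gx.
pose i : Eidx c := existT _ c (g, idc c).
have /(congr1 (fun h : E c => h i 1)) := ux.
by rewrite /= rep_map1 scale1r.
Qed.

Lemma Erep_injective : rep_injective Erep.
Proof.
move=> A B m u /rep_monoP m_inj.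
pose al d (phi : {additive F d -> QZ}) (x : A d) : QZ :=
  (u d x : E d) (existT _ d (phi, idc d)) 1.
have al_add d phi : zmod_morphism (@al d phi).
  by move=> x y; rewrite /al raddfB.
have be_ex (p : {d : C & {additive F d -> QZ}}) :
    exists g : {additive B (tag p) -> QZ},
      forall x, g (m (tag p) x) = al (tag p) (tagged p) x.
  case: p => d phi /=.
  apply: (@divisible_injective QZ QZ_div _ _ (m d) (mk_additive (al_add d phi))).
  by move=> x mx; have -> : x = 0 by [apply: m_inj; rewrite mx raddf0]; rewrite raddf0.
pose be p := sval (cid (be_ex p)).
have beP p : forall x, be p (m (tag p) x) = al (tag p) (tagged p) x.
  exact: svalP (cid (be_ex p)).
pose b c (i : Eidx c) := be (existT _ (tag i) (tagged i).1).
have v_add c (i : Eidx c) (y : B c) :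
    {morph (fun a => b c i (a *: rep_map B (tagged i).2 y)) : a b / a + b}.
  by move=> r s; rewrite scalerDl raddfD.
have v_lin c : linear (fun y => (fun i => Coind (v_add c i y)) : Erep c).
  move=> r x y; apply: functional_extensionality_dep => i; apply: coindP => a.
  by rewrite dprodD dprodZ /= linearP scalerDr raddfD scalerA.
unshelve eexists (@RepHom B Erep (fun c => mk_linear (v_lin c)) _).
  move=> c c' f y; apply: functional_extensionality_dep => i; apply: coindP => r.
  by rewrite /= rep_mapM.
move=> c x; apply: functional_extensionality_dep => -[d [phi f]].
apply: coindP => a /=.
rewrite -rep_hom_nat -linearZ /b [LHS](beP (existT _ d phi)) /al /=.
by rewrite linearZ /= rep_hom_nat /= mul1r /Eidx_map /= comp1c.
Qed.
End Embedding.

Section Resolution.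
Variable F : rep.

Fixpoint cosyzygy n : rep :=
  if n is m.+1 then crep (Erep_aug (cosyzygy m)) else F.

Definition Eres_d n : rep_hom (Erep (cosyzygy n)) (Erep (cosyzygy n.+1)) :=
  rep_comp (Erep_aug (cosyzygy n.+1)) (crep_pi (Erep_aug (cosyzygy n))).

Lemma Eres_dP n c y :
  Eres_d n c y = 0 <-> exists x, Erep_aug (cosyzygy n) c x = y.
Proof.
have /rep_monoP/(_ c) aug_inj := @Erep_aug_mono (cosyzygy n.+1).
have -> : Eres_d n c y =
    Erep_aug (cosyzygy n.+1) c (qpi (im_sub (Erep_aug (cosyzygy n) c)) y) by [].
have q0 := qpi_eq0 (im_sub (Erep_aug (cosyzygy n) c)) y.
split=> [e|/q0 ->]; last exact: raddf0.
by apply/q0/aug_inj; rewrite e; exact/esym/raddf0.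
Qed.

Lemma Eres_exactS n c y :
  Eres_d n.+1 c y = 0 <-> exists x, Eres_d n c x = y.
Proof.
rewrite Eres_dP; split=> [[x <-]|[x <-]]; last by exists (qpi _ x).
by have [z <-] := qpi_surj x; exists z.
Qed.

Lemma some_injective_resolution : injective_resolution F.
Proof.
refine (@InjectiveResolution F (fun n => Erep (cosyzygy n))
  (fun n => @Erep_injective _) Eres_d (Erep_aug F) (@Erep_aug_mono F)
  (@Eres_dP 0) Eres_exactS).
Qed.

(* The n-th right derived functor of lim: the resolution of F above is opaque, *)
(* so it is an arbitrary fixed one; by convention the result is 0 for n < 0.   *)
Definition rlim (n : int) : lmodType k :=
  match n with
  | Posz m => cohomology (fun i => lim_map (ires_d some_injective_resolution i)) m
  | Negz _ => 'rV[k]_0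
  end.
End Resolution.

Section Square.
Variables (cp : pairwise_coproducts C) (F : rep).

Program Definition rep_sq : rep :=
  @Rep (fun c => F (cop cp c c)) (fun a b f => rep_map F (cop_map cp f f)) _ _.
Next Obligation. by move=> a x; rewrite /= cop_map1 rep_map1. Qed.
Next Obligation. by move=> a b c g f x; rewrite /= cop_mapM rep_mapM. Qed.

Lemma rep_dbl_linear a b (f : hom a b) :
  linear (fun x : F a * F a => (rep_map F f x.1, rep_map F f x.2)).
Proof. by move=> r x y; rewrite !linearP. Qed.

Program Definition rep_dbl : rep :=
  @Rep (fun c => (F c * F c)%type) (fun a b f => mk_linear (@rep_dbl_linear a b f)) _ _.
Next Obligation. by move=> a [x y]; rewrite /= !rep_map1. Qed.
Next Obligation. by move=> a b c g f x; rewrite /= !rep_mapM. Qed.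

Lemma Tnat_linear c : linear (fun x : F c * F c =>
  rep_map F (in1 cp c c) x.1 + rep_map F (in2 cp c c) x.2).
Proof. by move=> r x y; rewrite /= !linearP /= scalerDr addrACA. Qed.

Program Definition Tnat : rep_hom rep_dbl rep_sq :=
  @RepHom rep_dbl rep_sq (fun c => mk_linear (@Tnat_linear c)) _.
Next Obligation.
by move=> a b f x; rewrite /= linearD -!rep_mapM /cop_map copair1 copair2.
Qed.

Definition monoadditive : Prop := rep_mono Tnat.

Definition Sigma : rep := crep Tnat.
End Square.
End Representations.

(* Main.v *)
From mathcomp Require Import all_boot all_algebra.
From mathcomp Require Import boolp.
Require Import Defs.

(** Write D = F(i2) - F(i1) : F -> F_sq and let K be the kernel of the fold map
    F_sq -> F induced by c + c -> c.  The fold map splits F(i1), so that F_sq is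
    F + K and the square in the definition of Sigma F collapses: F is
    monoadditive exactly when D is injective, D lands in K, and its cokernel in
    K is Sigma F.  This gives a short exact sequence
      0 -> F -> K -> Sigma F -> 0
    ([fold_ker_exact]), and the proposition is the dimension shift along it, as
    soon as every derived limit of K vanishes.

    The vanishing comes from one observation: a compatible family x satisfies
    F(i1) x_c = x_(c + c) = F(i2) x_c, so D induces zero on limits, for every
    representation.  On K, however, D is split: there is a natural
    th : K_sq -> K with th D = id ([fold_ker_split]).  Given an injective
    resolution R of K, extend th to a chain map T : R_sq -> R, which is possible
    because R_sq is exact and R is injective.  Then T D : R -> R lifts the
    identity of K, hence is homotopic to the identity, while it is zero on
    lim R; so the complex lim R is exact ([lim_resolution_acyclic]).

    For the dimension shift, let A and B be the given injective resolutions of F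
    and of Sigma F.  The horseshoe construction makes A + B, with the
    differential twisted by maps t : B_n -> A_(n+1), into an injective
    resolution of K ([cone_resolution]).  Since the vanishing result applies to
    every injective resolution of K, the limit of this cone is exact, which says
    that t induces isomorphisms H^n(lim B) -> H^(n+1)(lim A) and that
    H^0(lim A) = 0 ([cone_cohomologyS], [cone_cohomology0]). *)

Set Implicit Arguments.
Unset Strict Implicit.
Unset Printing Implicit Defensive.

Import GRing.Theory.
Local Open Scope ring_scope.

(** * Maps into injective representations *)

(** Dependent choice for sequences whose terms live in varying types; it builds
    chain maps and homotopies degree by degree. *)
Lemma dependent_choice_nat (P : nat -> Type)
    (Q : forall n, P n -> P n.+1 -> Prop) (p0 : P 0%N) :
    (forall n (p : P n), exists q, Q n p q) ->
  exists2 s : forall n, P n, s 0%N = p0 & forall n, Q n (s n) (s n.+1).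
Proof.
move=> step.
pose s := fix s n : P n :=
  if n is m.+1 then sval (cid (step m (s m))) else p0.
by exists s => // n; exact: svalP (cid (step n (s n))).
Qed.

Lemma linear_injective (k : pzRingType) (U V : lmodType k) (f : {linear U -> V}) :
  (forall x, f x = 0 -> x = 0) -> injective f.
Proof.
move=> ker0 x y fxy; apply/eqP; rewrite -subr_eq0; apply/eqP/ker0.
by apply: etrans (raddfB f x y) _; apply/eqP; rewrite subr_eq0; apply/eqP.
Qed.

Section RepHoms.
Variables (k : comPzRingType) (C : category).
Implicit Types F G H I : rep k C.

Program Definition rep_id F : rep_hom F F :=
  @RepHom k C F F (fun c => idfun) _.

Program Definition rep_sub F G (u v : rep_hom F G) : rep_hom F G :=
  @RepHom k C F G (fun c => u c \- v c) _.
Next Obligation. by rewrite !rep_hom_nat raddfB. Qed.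

Program Definition rep_opp F G (u : rep_hom F G) : rep_hom F G :=
  @RepHom k C F G (fun c => \- u c) _.
Next Obligation. by rewrite rep_hom_nat raddfN. Qed.

Lemma crep_lift F G H (u : rep_hom F G) (w : rep_hom G H) :
    (forall c x, w c (u c x) = 0) ->
  exists w' : rep_hom (crep u) H, forall c x, w' c (crep_pi u c x) = w c x.
Proof.
move=> wu.
have w0 c y : im_sub (u c) y -> w c y = 0 by move=> [x <-].
unshelve eexists (@RepHom k C (crep u) H (fun c => qlift (w0 c)) _).
  move=> a b f x; have [y <-] := qpi_surj x.
  rewrite (qliftE (w0 a)) -rep_hom_nat -(qliftE (w0 b)).
  by congr (qlift _ _); exact/esym/(rep_hom_nat (crep_pi u)).
by move=> c x; exact: (qliftE (w0 c)).
Qed.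

Lemma crep_pi_surj F G (u : rep_hom F G) c (z : crep u c) :
  exists y, crep_pi u c y = z.
Proof. exact: qpi_surj. Qed.

Lemma crep_pi_eq0 F G (u : rep_hom F G) c y :
  crep_pi u c y = 0 <-> exists x, u c x = y.
Proof. exact: (qpi_eq0 (im_sub (u c))). Qed.

(** Injectivity of I only speaks of monomorphisms; the general case follows by
    replacing g with the monomorphism that it induces on the coimage of g. *)
Lemma injective_extend F G I (g : rep_hom F G) (u : rep_hom F I) :
    rep_injective I -> (forall c x, g c x = 0 -> u c x = 0) ->
  exists v : rep_hom G I, forall c x, v c (g c x) = u c x.
Proof.
move=> I_inj ker_gu; pose ker_val := krep_val g.
have [g' g'E] : exists g' : rep_hom (crep ker_val) G,
    forall c x, g' c (crep_pi ker_val c x) = g c x.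
  by apply: crep_lift => c x; exact: submodP x.
have [u' u'E] : exists u' : rep_hom (crep ker_val) I,
    forall c x, u' c (crep_pi ker_val c x) = u c x.
  by apply: crep_lift => c x; apply: ker_gu; exact: submodP x.
have g'_mono : rep_mono g'.
  apply/rep_monoP => c; apply: linear_injective => z.
  have [x <-] := crep_pi_surj z; rewrite g'E => gx.
  by apply/crep_pi_eq0; exists (mk_submod (gx : ker_sub (g c) x)).
have [v vE] := I_inj _ _ g' u' g'_mono.
by exists v => c x; rewrite -g'E -u'E; exact: (vE c).
Qed.

(** * Comparison of resolutions *)

Section Comparison.
Variables (Z I : nat -> rep k C).
Variable d : forall n, rep_hom (Z n) (Z n.+1).
Hypothesis Z_exact : forall n c y, d n.+1 c y = 0 -> exists x, d n c x = y.
Hypothesis I_inj : forall n, rep_injective (I n).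

(** The condition on t0 is what a map of augmentations provides.  It carries over
    to every degree n as: e t_n kills the cycles of Z_n, so that e t_n extends
    along d_n, and the extension t_(n+1) satisfies e t_(n+1) d = e e t_n = 0. *)
Lemma chain_map_extend (e : forall n, rep_hom (I n) (I n.+1))
    (t0 : rep_hom (Z 0%N) (I 0%N)) :
    (forall n c x, e n.+1 c (e n c x) = 0) ->
    (forall c x, d 0 c x = 0 -> e 0%N c (t0 c x) = 0) ->
  exists2 t : forall n, rep_hom (Z n) (I n), t 0%N = t0 &
    forall n c x, t n.+1 c (d n c x) = e n c (t n c x).
Proof.
move=> ee t0P.
pose P n := {t : rep_hom (Z n) (I n) |
  forall c x, d n c x = 0 -> e n c (t c x) = 0}.
pose Q n (p : P n) (q : P n.+1) :=
  forall c x, sval q c (d n c x) = e n c (sval p c x).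
have [n [t tP]|s s0 sP] := @dependent_choice_nat P Q (exist _ t0 t0P).
  have [t' t'E] := injective_extend (u := rep_comp (e n) t) (@I_inj n.+1) tP.
  have t'P c x : d n.+1 c x = 0 -> e n.+1 c (t' c x) = 0.
    by move=> /Z_exact[y <-]; rewrite t'E; exact: ee.
  by exists (exist _ t' t'P) => c x; exact: t'E.
by exists (fun n => sval (s n)) => [|n c x]; [rewrite s0|exact: sP].
Qed.

(** The fundamental lemma of homological algebra for a chain map z that lifts zero:
    if h_n has been built, then z_(n+1) - e h_n kills the boundaries, which are
    the cycles, so it extends along d_(n+1) to h_(n+1). *)
Lemma null_homotopy (e : forall n, rep_hom (I n) (I n.+1))
    (z : forall n, rep_hom (Z n) (I n)) :
    (forall n c x, e n.+1 c (e n c x) = 0) ->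
    (forall n c x, z n.+1 c (d n c x) = e n c (z n c x)) ->
    (forall c x, d 0 c x = 0 -> z 0%N c x = 0) ->
  exists h : forall n, rep_hom (Z n.+1) (I n),
    (forall c x, z 0%N c x = h 0%N c (d 0 c x)) /\
    (forall n c x, z n.+1 c x = h n.+1 c (d n.+1 c x) + e n c (h n c x)).
Proof.
move=> ee zd z0.
have [h0 h0E] := injective_extend (@I_inj 0) z0.
(* Since (z_(n+1) - e h_n) d = e z_n - e h_n d, this invariant says that
   z_(n+1) - e h_n vanishes on boundaries. *)
pose P n := {h : rep_hom (Z n.+1) (I n) |
  forall c x, e n c (h c (d n c x)) = e n c (z n c x)}.
pose Q n (p : P n) (q : P n.+1) :=
  forall c x, z n.+1 c x = sval q c (d n.+1 c x) + e n c (sval p c x).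
have h0P c x : e 0%N c (h0 c (d 0 c x)) = e 0%N c (z 0%N c x) by rewrite h0E.
have [n [h hP]|s s0 sP] := @dependent_choice_nat P Q (exist _ h0 h0P).
  have [|h' h'E] := injective_extend (g := d n.+1)
      (u := rep_sub (z n.+1) (rep_comp (e n) h)) (@I_inj n.+1).
    by move=> c x /Z_exact[y <-] /=; rewrite zd hP subrr.
  have h'P c x : e n.+1 c (h' c (d n.+1 c x)) = e n.+1 c (z n.+1 c x).
    by rewrite h'E /= raddfB /= ee subr0.
  by exists (exist _ h' h'P) => c x; rewrite /= h'E /= subrK.
exists (fun n => sval (s n)); split=> [c x|n c x]; last exact: sP.
by rewrite s0 /= h0E.
Qed.
End Comparison.

Lemma ires_dd F (R : injective_resolution F) n c x :
  ires_d R n.+1 c (ires_d R n c x) = 0.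
Proof. by apply/ires_exactS; exists x. Qed.

Lemma ires_d_aug F (R : injective_resolution F) c x :
  ires_d R 0 c (ires_aug R c x) = 0.
Proof. by apply/ires_exact0; exists x. Qed.

Lemma ires_aug_inj F (R : injective_resolution F) c : injective (ires_aug R c).
Proof. exact: (rep_monoP (ires_aug R)).1 (ires_aug_mono (i := R)) c. Qed.

Lemma limP F (x y : lim F) : (forall c, val x c = val y c) -> x = y.
Proof.
by move=> xy; apply: val_inj; apply: functional_extensionality_dep => c; exact: xy.
Qed.

End RepHoms.

(** * Representations with vanishing derived limits *)

Section Acyclicity.
Variables (k : comPzRingType) (C : category) (cp : pairwise_coproducts C).
Implicit Types F G : rep k C.

Program Definition rep_sq_hom F G (u : rep_hom F G) :
    rep_hom (rep_sq cp F) (rep_sq cp G) :=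
  @RepHom k C (rep_sq cp F) (rep_sq cp G) (fun c => u (cop cp c c)) _.
Next Obligation. exact: rep_hom_nat. Qed.

Program Definition cop_diff F : rep_hom F (rep_sq cp F) :=
  @RepHom k C F (rep_sq cp F)
    (fun c => rep_map F (in2 cp c c) \- rep_map F (in1 cp c c)) _.
Next Obligation.
by rewrite /= raddfB /= -!rep_mapM /cop_map copair1 copair2.
Qed.

(** A compatible family takes the same value x_(c + c) along both coprojections. *)
Lemma cop_diff_lim F (x : lim F) c : cop_diff F c (val x c) = 0.
Proof. by rewrite /= !(submodP x) subrr. Qed.

Lemma cop_diff_nat F G (u : rep_hom F G) c x :
  cop_diff G c (u c x) = u (cop cp c c) (cop_diff F c x).
Proof. by rewrite /= raddfB /= !rep_hom_nat. Qed.

(** [cop_diff] vanishes on limits, so a representation on which it is a split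
    monomorphism has no derived limits: lifting the splitting th to a chain map t
    on resolutions, t D lifts the identity and is zero on limits, and the
    homotopy between t D and the identity contracts the complex of limits. *)
Lemma lim_resolution_acyclic F (th : rep_hom (rep_sq cp F) F)
    (R : injective_resolution F) n (x : lim (R n)) :
    (forall c y, th c (cop_diff F c y) = y) ->
    lim_map (ires_d R n) x = 0 ->
  coboundary (fun i => lim_map (ires_d R i)) x.
Proof.
move=> thK dx0.
have dx c : ires_d R n c (val x c) = 0.
  exact: (congr1 (fun y : lim (R n.+1) => val y c) dx0).
pose d_sq i := rep_sq_hom (ires_d R i).
have [|t0 t0E] := injective_extend (g := rep_sq_hom (ires_aug R))
    (u := rep_comp (ires_aug R) th) (@ires_inj _ _ _ R 0%N).
  move=> c y augy; suff -> : y = 0 by exact: raddf0.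
  by apply: (@ires_aug_inj _ _ _ R (cop cp c c)); rewrite raddf0; exact: augy.
have [||t tt0 tE] := chain_map_extend (d := d_sq) (e := ires_d R) (t0 := t0)
    _ (@ires_inj _ _ _ R) (@ires_dd _ _ _ R).
- by move=> i c y /ires_exactS.
- by move=> c y /ires_exact0[w <-]; rewrite t0E; exact: ires_d_aug.
(* z lifts th D - id = 0, and acts on limits as - id. *)
pose z i := rep_sub (rep_comp (t i) (cop_diff (R i))) (rep_id (R i)).
have [| | |h [h0 hS]] := null_homotopy (d := ires_d R) (e := ires_d R) (z := z)
    _ (@ires_inj _ _ _ R) (@ires_dd _ _ _ R).
- by move=> i c y /ires_exactS.
- move=> i c y; rewrite [LHS]/= [X in ires_d R i c X]/= [RHS]raddfB.
  by congr (_ - _); rewrite -[LHS]/(t i.+1 c (cop_diff _ _ _)) cop_diff_nat [LHS]tE.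
- move=> c y /ires_exact0[w <-].
  rewrite -[LHS]/(t 0%N c (cop_diff _ _ _) - ires_aug R c w).
  by rewrite cop_diff_nat tt0 [X in X - _]t0E /= thK subrr.
have zx c : z n c (val x c) = - val x c.
  by rewrite -[LHS]/(t n c (cop_diff _ _ _) - val x c) cop_diff_lim raddf0 sub0r.
case: n x dx0 dx zx => [|n] x dx0 dx zx /=.
  by apply: limP => c; apply: oppr_inj; rewrite -zx h0 dx !raddf0.
exists (- lim_map (h n) x); apply: limP => c.
rewrite -[LHS]/(ires_d R n c (- h n c (val x c))) raddfN.
by apply: oppr_inj; rewrite opprK -zx hS dx raddf0 add0r.
Qed.
End Acyclicity.

(** * The kernel of the fold map *)

Section FoldKernel.
Variables (k : comPzRingType) (C : category) (cp : pairwise_coproducts C).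
Implicit Types F G : rep k C.

Lemma comp_copair (a b d e : C) (h : hom d e) (f : hom a d) (g : hom b d) :
  comp h (copair cp f g) = copair cp (comp h f) (comp h g).
Proof. by apply: copair_uniq; rewrite -compcA ?copair1 ?copair2. Qed.

Lemma copair_cop_map (a b a' b' d : C) (f : hom a' d) (g : hom b' d)
    (p : hom a a') (q : hom b b') :
  comp (copair cp f g) (cop_map cp p q) = copair cp (comp f p) (comp g q).
Proof. by rewrite comp_copair !compcA copair1 copair2. Qed.

Lemma copair_in (a b : C) : copair cp (in1 cp a b) (in2 cp a b) = idc _.
Proof. by apply/esym/copair_uniq; rewrite comp1c. Qed.

Definition fold (c : C) : hom (cop cp c c) c := copair cp (idc c) (idc c).

Lemma fold_nat (a b : C) (f : hom a b) :
  comp (fold b) (cop_map cp f f) = comp f (fold a).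
Proof. by rewrite copair_cop_map comp_copair !comp1c !compc1. Qed.

Program Definition rep_fold F : rep_hom (rep_sq cp F) F :=
  @RepHom k C (rep_sq cp F) F (fun c => rep_map F (fold c)) _.
Next Obligation. by rewrite /= -!rep_mapM fold_nat. Qed.

Definition fold_ker F := krep (rep_fold F).

Lemma krep_lift F G H (u : rep_hom F G) (w : rep_hom H F) :
    (forall c x, u c (w c x) = 0) ->
  exists w' : rep_hom H (krep u), forall c x, val (w' c x) = w c x.
Proof.
move=> uw.
have lin c : linear (fun x : H c => mk_submod (uw c x : ker_sub (u c) _)).
  by move=> r x y; apply: val_inj; exact: linearP.
unshelve eexists (@RepHom k C H (krep u) (fun c => mk_linear (lin c)) _).
  by move=> a b f x; apply: val_inj; exact: rep_hom_nat.
by [].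
Qed.

(** The map (c + c) + (c + c) -> c + c that folds the first summand into the first
    copy of c and is the identity on the second.  Composed with i1 + i1 it gives
    i1 fold, which is zero on the kernel of the fold map, and composed with
    i2 + i2 it gives the identity. *)
Definition fold_left (c : C) : hom (cop cp (cop cp c c) (cop cp c c)) (cop cp c c) :=
  copair cp (comp (in1 cp c c) (fold c)) (idc _).

Lemma fold_left_nat (a b : C) (f : hom a b) :
  comp (fold_left b) (cop_map cp (cop_map cp f f) (cop_map cp f f)) =
  comp (cop_map cp f f) (fold_left a).
Proof.
rewrite [LHS]copair_cop_map [RHS]comp_copair comp1c compc1 -compcA fold_nat.
by rewrite !compcA copair1.
Qed.

(** Both sides send all four copies of c to c identically; hence F(fold_left)
    restricts to the kernels of the fold maps. *)
Lemma fold_fold_left (c : C) :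
  comp (fold c) (fold_left c) = comp (fold c) (fold (cop cp c c)).
Proof.
by rewrite [LHS]comp_copair [RHS]comp_copair !compc1 compcA copair1 comp1c.
Qed.

Program Definition rep_fold_left F : rep_hom (rep_sq cp (rep_sq cp F)) (rep_sq cp F) :=
  @RepHom k C (rep_sq cp (rep_sq cp F)) (rep_sq cp F)
    (fun c => rep_map F (fold_left c)) _.
Next Obligation. by rewrite /= -!rep_mapM fold_left_nat. Qed.

(** On the subrepresentation K of F_sq, the difference of the two coprojections is
    F(i2 + i2) - F(i1 + i1); composed with F(fold_left) it is the identity minus
    F(i1 fold), and the latter vanishes on K. *)
Lemma fold_ker_split F : exists th : rep_hom (rep_sq cp (fold_ker F)) (fold_ker F),
  forall c y, th c (cop_diff cp (fold_ker F) c y) = y.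
Proof.
have [|th thE] := krep_lift (u := rep_fold F)
  (w := rep_comp (rep_fold_left F) (rep_sq_hom cp (krep_val (rep_fold F)))).
  move=> c y; rewrite /= -rep_mapM fold_fold_left rep_mapM.
  by rewrite -[RHS](raddf0 (rep_map F (fold c))); congr (rep_map F _ _); exact: submodP y.
exists th => c y; apply: val_inj; rewrite thE /= raddfB /= -!rep_mapM.
rewrite !copair_cop_map !comp1c -!compcA !copair1 !copair2 compc1 copair_in rep_map1.
have -> : copair cp (in1 cp c c) (in1 cp c c) = comp (in1 cp c c) (fold c).
  by rewrite comp_copair !compc1.
rewrite rep_mapM; have -> : rep_map F (fold c) (val y) = 0 by exact: submodP y.
by rewrite raddf0 subr0.
Qed.

(** The map io is [cop_diff], and p is the restriction of F_sq -> Sigma F.  An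
    element F(i1) x1 + F(i2) x2 of F_sq folds to x1 + x2, so inside the kernel of
    the fold map the image of T is the image of D; and y and
    y - F(i1) F(fold) y have the same class in Sigma F, so p is onto. *)
Lemma fold_ker_exact F : monoadditive cp F ->
  exists (io : rep_hom F (fold_ker F)) (p : rep_hom (fold_ker F) (Sigma cp F)),
    [/\ forall c x, io c x = 0 -> x = 0,
        forall c y, p c y = 0 <-> exists x, io c x = y
      & forall c z, exists y, p c y = z].
Proof.
move=> F_mono; have T_inj := (rep_monoP (Tnat cp F)).1 F_mono.
have [|io ioE] := krep_lift (u := rep_fold F) (w := cop_diff cp F).
  by move=> c x; rewrite /= raddfB /= -!rep_mapM copair1 copair2 subrr.
have TE c x y : Tnat cp F c (x, y) =
  rep_map F (in1 cp c c) x + rep_map F (in2 cp c c) y by [].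
exists io, (rep_comp (crep_pi (Tnat cp F)) (krep_val (rep_fold F))); split.
- move=> c x io0; have := congr1 val io0; rewrite ioE /= addrC => Tx.
  have : Tnat cp F c (- x, x) = Tnat cp F c 0.
    by rewrite TE raddfN Tx raddf0.
  by move=> /T_inj[].
- move=> c y; rewrite -[p in p = 0 <-> _]/(crep_pi (Tnat cp F) c (val y)).
  split=> [/crep_pi_eq0[[x1 x2] xy]|[x <-]]; last first.
    apply/crep_pi_eq0; exists (- x, x).
    by rewrite ioE TE raddfN addrC.
  exists x2; apply: val_inj; rewrite ioE -xy TE /= addrC; congr (_ + _).
  have : rep_map F (fold c) (Tnat cp F c (x1, x2)) = 0.
    by rewrite xy; exact: submodP y.
  rewrite TE raddfD /= -!rep_mapM copair1 copair2 !rep_map1 => /eqP.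
  by rewrite addr_eq0 => /eqP ->; rewrite raddfN.
- move=> c z; have [y <-] := crep_pi_surj z.
  have y0 : ker_sub (rep_fold F c) (y - rep_map F (comp (in1 cp c c) (fold c)) y).
    by rewrite /= raddfB /= rep_mapM -!rep_mapM compcA copair1 comp1c subrr.
  exists (mk_submod y0); rewrite -[LHS]/(crep_pi _ c (y - _)).
  rewrite raddfB -[RHS]subr0; congr (_ - _); apply/crep_pi_eq0.
  by exists (rep_map F (fold c) y, 0); rewrite TE raddf0 addr0 rep_mapM.
Qed.
End FoldKernel.

(** * Cohomology of an exact cone *)

Section LinearIso.
Variable k : comPzRingType.

Lemma inverse_lmod_iso (U V : lmodType k) (f : {linear U -> V}) :
  (forall x, f x = 0 -> x = 0) -> (forall y, exists x, f x = y) -> lmod_iso V U.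
Proof.
move=> ker0 surj; pose g y := sval (cid (surj y)).
have fg y : f (g y) = y by exact: svalP (cid (surj y)).
have f_inj := linear_injective ker0.
have g_lin : linear g by move=> a x y; apply: f_inj; rewrite linearP !fg.
by exists (mk_linear g_lin); exists f => x; [exact: fg|apply: f_inj; exact: fg].
Qed.

Lemma lmod_iso0 (U V : lmodType k) :
  (forall x : U, x = 0) -> (forall y : V, y = 0) -> lmod_iso U V.
Proof.
move=> U0 V0.
have lin0 : linear (fun _ : U => 0 : V) by move=> a x y; rewrite scaler0 addr0.
by exists (mk_linear lin0); exists (fun _ => 0) => x; rewrite [LHS]/= ?(U0 x) ?(V0 x).
Qed.

(** [cone0] and [coneS] say that the complex X_n + Y_n with differential
    (a, b) |-> (dX a + t b, dY b) is exact. *)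
Section Cone.
Variables (X Y : nat -> lmodType k).
Variables (dX : forall n, {linear X n -> X n.+1}).
Variables (dY : forall n, {linear Y n -> Y n.+1}).
Variables (t : forall n, {linear Y n -> X n.+1}).
Hypothesis tN : forall n b, t n.+1 (dY n b) = - dX n.+1 (t n b).
Hypothesis cone0 : forall a b,
  dX 0 a + t 0%N b = 0 -> dY 0 b = 0 -> a = 0 /\ b = 0.
Hypothesis coneS : forall n a b,
    dX n.+1 a + t n.+1 b = 0 -> dY n.+1 b = 0 ->
  exists a' b', dX n a' + t n b' = a /\ dY n b' = b.

Lemma cone_cohomology0 (x : cohomology dX 0) : x = 0.
Proof.
have [a <-] := qpi_surj x; apply/qpi_eq0.
by have [] := @cone0 (val a) 0; rewrite ?raddf0 ?addr0 //; exact: submodP a.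
Qed.

Lemma cone_coboundary n (b : Y n) :
  coboundary dY b -> coboundary dX (t n b : X n.+1).
Proof.
case: n b => [|n] b /= => [->|[b' <-]]; first by exists 0; rewrite !raddf0.
by exists (- t n b'); rewrite tN raddfN.
Qed.

(** The pair (- a, b) is a cocycle of the cone, hence a coboundary. *)
Lemma cone_coboundary_inv n (a : X n) (b : Y n) :
  dX n a = t n b -> dY n b = 0 -> coboundary dY b.
Proof.
move=> ab b0; have ab0 : dX n (- a) + t n b = 0 by rewrite raddfN /= ab addNr.
case: n a b ab b0 ab0 => [|n] a b _ b0 ab0 /=; first by have [] := cone0 ab0 b0.
by have [a' [b' [_ b'b]]] := coneS ab0 b0; exists b'.
Qed.

(** The isomorphism is the inverse of the one that t induces.  For surjectivity, a
    cocycle a of X gives the cocycle (a, 0) of the cone; writing it as the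
    coboundary of (a', b') exhibits a as cohomologous to t b'. *)
Lemma cone_cohomologyS n : lmod_iso (cohomology dX n.+1) (cohomology dY n).
Proof.
pose ZY := submod (ker_sub (dY n)); pose ZX := submod (ker_sub (dX n.+1)).
have tZ (b : ZY) : ker_sub (dX n.+1) (t n (val b)).
  apply: oppr_inj; rewrite -tN oppr0 -[RHS](raddf0 (t n.+1)).
  by congr (t n.+1 _); exact: submodP b.
have lin : linear (fun b : ZY => mk_submod (tZ b) : ZX).
  by move=> r x y; apply: val_inj; exact: linearP.
pose pX : {linear ZX -> cohomology dX n.+1} := qpi (coboundary_sub dX n.+1).
pose pY : {linear ZY -> cohomology dY n} := qpi (coboundary_sub dY n).
have t0 (b : ZY) : coboundary_sub dY n b -> (pX \o mk_linear lin) b = 0.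
  by move=> bB; apply/qpi_eq0/cone_coboundary.
have fE : forall b, qlift t0 (pY b) = pX (mk_submod (tZ b)) by exact: qliftE.
apply: (@inverse_lmod_iso _ _ (qlift t0)) => [y|x].
  have [b <-] := qpi_surj y; rewrite fE => /qpi_eq0[a /= ab].
  by apply/qpi_eq0; apply: cone_coboundary_inv ab _; exact: submodP b.
have [a <-] := qpi_surj x.
have [||a' [b' [ab b0]]] := @coneS n (val a) 0.
- by rewrite raddf0 addr0; exact: submodP a.
- exact: raddf0.
exists (pY (mk_submod (b0 : ker_sub (dY n) b'))); rewrite fE.
apply/qpi_eq; exists (- a').
by rewrite raddfN /= -ab opprD addrC subrK.
Qed.
End Cone.
End LinearIso.

(** * Direct sums of representations *)

Section DirectSum.
Variables (k : comPzRingType) (C : category).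
Implicit Types F G H I : rep k C.

Lemma rep_sum_map_linear F G (a b : C) (f : hom a b) :
  linear (fun x : F a * G a => (rep_map F f x.1, rep_map G f x.2)).
Proof. by move=> r x y; rewrite !linearP. Qed.

Program Definition rep_sum F G : rep k C :=
  @Rep k C (fun c => (F c * G c)%type)
    (fun a b f => mk_linear (@rep_sum_map_linear F G a b f)) _ _.
Next Obligation. by rewrite !rep_map1. Qed.
Next Obligation. by rewrite !rep_mapM. Qed.

Lemma rep_pair_linear F G H (u : rep_hom H F) (v : rep_hom H G) c :
  linear (fun x : H c => (u c x, v c x)).
Proof. by move=> r x y; rewrite !linearP. Qed.

Program Definition rep_pair F G H (u : rep_hom H F) (v : rep_hom H G) :
    rep_hom H (rep_sum F G) :=
  @RepHom k C H (rep_sum F G) (fun c => mk_linear (rep_pair_linear u v (c := c))) _.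
Next Obligation. by rewrite !rep_hom_nat. Qed.

Lemma rep_fst_linear F G c : linear (fun x : rep_sum F G c => x.1).
Proof. by []. Qed.

Program Definition rep_fst F G : rep_hom (rep_sum F G) F :=
  @RepHom k C (rep_sum F G) F (fun c => mk_linear (@rep_fst_linear F G c)) _.

Lemma rep_snd_linear F G c : linear (fun x : rep_sum F G c => x.2).
Proof. by []. Qed.

Program Definition rep_snd F G : rep_hom (rep_sum F G) G :=
  @RepHom k C (rep_sum F G) G (fun c => mk_linear (@rep_snd_linear F G c)) _.

Lemma rep_sum_injective F G :
  rep_injective F -> rep_injective G -> rep_injective (rep_sum F G).
Proof.
move=> F_inj G_inj A B m u m_mono.
have [v vE] := F_inj _ _ m (rep_comp (rep_fst F G) u) m_mono.
have [w wE] := G_inj _ _ m (rep_comp (rep_snd F G) u) m_mono.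
exists (rep_pair v w) => c x; rewrite [RHS]surjective_pairing.
by congr (_, _); [exact: (vE c)|exact: (wE c)].
Qed.

Program Definition rep_add F G (u v : rep_hom F G) : rep_hom F G :=
  @RepHom k C F G (fun c => u c \+ v c) _.
Next Obligation. by rewrite !rep_hom_nat raddfD. Qed.

End DirectSum.

(** * Dimension shift along a short exact sequence *)

Section DimensionShift.
Variables (k : comPzRingType) (C : category) (F K S : rep k C).
Variables (io : rep_hom F K) (p : rep_hom K S).
Hypothesis io_inj : forall c x, io c x = 0 -> x = 0.
Hypothesis io_p_exact : forall c y, p c y = 0 <-> exists x, io c x = y.
Hypothesis p_surj : forall c z, exists y, p c y = z.

Variables (A : injective_resolution F) (B : injective_resolution S).

(** Extend the augmentation of A along io to sg : K -> A_0.  Then d sg vanishes on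
    F, so it factors as v p with v : S -> A_1, and - v lifts to a chain map t from
    B to the complex A shifted by one, with the opposite differential. *)
Lemma twisting_maps :
  exists (sg : rep_hom K (A 0%N)) (t : forall n, rep_hom (B n) (A n.+1)),
    [/\ forall c x, sg c (io c x) = ires_aug A c x,
        forall c y, ires_d A 0 c (sg c y) + t 0%N c (ires_aug B c (p c y)) = 0
      & forall n c b, t n.+1 c (ires_d B n c b) = - ires_d A n.+1 c (t n c b)].
Proof.
have [|sg sgE] := injective_extend (g := io) (u := ires_aug A) (@ires_inj _ _ _ A 0%N).
  by move=> c x /io_inj ->; exact: raddf0.
have [|v vE] := injective_extend (g := p) (u := rep_comp (ires_d A 0) sg)
    (@ires_inj _ _ _ A 1%N).
  by move=> c y /io_p_exact[x <-]; rewrite /= sgE ires_d_aug.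
have [|t0 t0E] := injective_extend (g := ires_aug B) (u := rep_opp v)
    (@ires_inj _ _ _ A 1%N).
  move=> c z augz; suff -> : z = 0 by exact: raddf0.
  by apply: (@ires_aug_inj _ _ _ B c); rewrite augz raddf0.
have [|||t tt0 tE] := chain_map_extend (Z := B) (I := fun n => A n.+1)
    (d := ires_d B) (e := fun n => rep_opp (ires_d A n.+1)) (t0 := t0)
    _ (fun n => @ires_inj _ _ _ A n.+1).
- by move=> n c y /ires_exactS.
- by move=> n c x; rewrite /= raddfN /= ires_dd !oppr0.
- move=> c _ /ires_exact0[z <-]; have [y <-] := p_surj z.
  by rewrite t0E /= vE /= raddfN /= ires_dd !oppr0.
exists sg, t; split=> // c y.
by rewrite tt0 t0E /= vE /= addrN.
Qed.

Variables (sg : rep_hom K (A 0%N)) (t : forall n, rep_hom (B n) (A n.+1)).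
Hypothesis sg_io : forall c x, sg c (io c x) = ires_aug A c x.
Hypothesis t_aug :
  forall c y, ires_d A 0 c (sg c y) + t 0%N c (ires_aug B c (p c y)) = 0.
Hypothesis t_d :
  forall n c b, t n.+1 c (ires_d B n c b) = - ires_d A n.+1 c (t n c b).

Definition cone_ob n : rep k C := rep_sum (A n) (B n).

Definition cone_d n : rep_hom (cone_ob n) (cone_ob n.+1) :=
  rep_pair (rep_add (rep_comp (ires_d A n) (rep_fst _ _))
                    (rep_comp (t n) (rep_snd _ _)))
           (rep_comp (ires_d B n) (rep_snd _ _)).

Definition cone_aug : rep_hom K (cone_ob 0) :=
  rep_pair sg (rep_comp (ires_aug B) p).

Lemma cone_aug_mono : rep_mono cone_aug.
Proof.
apply/rep_monoP => c; apply: linear_injective => y [sgy augy].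
have : p c y = 0 by apply: (@ires_aug_inj _ _ _ B c); rewrite augy raddf0.
move=> /io_p_exact[x xy]; rewrite -xy.
suff -> : x = 0 by exact: raddf0.
by apply: (@ires_aug_inj _ _ _ A c); rewrite -sg_io xy sgy raddf0.
Qed.

(** A cycle (a, b) has b = aug_B (p y) for some y; subtracting the image of y
    leaves a cycle (a - sg y, 0), and a - sg y comes from F. *)
Lemma cone_exact0 c z : cone_d 0 c z = 0 <-> exists y, cone_aug c y = z.
Proof.
case: z => a b; split=> [[dab db]|[y [<- <-]]]; last first.
  by rewrite /= t_aug ires_d_aug.
have [s sb] := (@ires_exact0 _ _ _ B c b).1 db; have [y ys] := p_surj s.
have [x xa] : exists x, ires_aug A c x = a - sg c y.
  apply/ires_exact0; rewrite raddfB /=; apply/eqP; rewrite subr_eq0; apply/eqP.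
  apply: (addIr (t 0%N c b)); rewrite dab.
  by rewrite -sb -ys t_aug.
exists (y + io c x); rewrite [LHS]/= !raddfD /= sg_io xa ys sb.
have -> : p c (io c x) = 0 by apply/io_p_exact; exists x.
by rewrite raddf0 addr0 addrC subrK.
Qed.

Lemma cone_exactS n c z : cone_d n.+1 c z = 0 <-> exists y, cone_d n c y = z.
Proof.
case: z => a b; split=> [[dab db]|[[a' b'] [<- <-]]]; last first.
  by rewrite /= raddfD /= !ires_dd add0r t_d addrN.
have [b' b'b] := (@ires_exactS _ _ _ B n c b).1 db.
have [a' a'a] : exists a', ires_d A n c a' = a - t n c b'.
  by apply/ires_exactS; rewrite raddfB /= -t_d b'b.
by exists (a', b'); rewrite /= a'a b'b subrK.
Qed.

Definition cone_resolution : injective_resolution K :=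
  @InjectiveResolution k C K cone_ob
    (fun n => rep_sum_injective (@ires_inj _ _ _ A n) (@ires_inj _ _ _ B n))
    cone_d cone_aug cone_aug_mono cone_exact0 cone_exactS.

End DimensionShift.

(** Acyclicity of K is used on a single resolution: the cone over the two
    resolutions that define the derived limits of F and of S. *)
Lemma lim_dimension_shift (k : comPzRingType) (C : category) (F K S : rep k C)
    (io : rep_hom F K) (p : rep_hom K S) (n : nat) :
    (forall c x, io c x = 0 -> x = 0) ->
    (forall c y, p c y = 0 <-> exists x, io c x = y) ->
    (forall c z, exists y, p c y = z) ->
    (forall (R : injective_resolution K) i (x : lim (R i)),
      lim_map (ires_d R i) x = 0 -> coboundary (fun j => lim_map (ires_d R j)) x) ->
  lmod_iso (rlim F n%:Z) (rlim S (n%:Z - 1)).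
Proof.
move=> io_inj io_p p_surj K_acyclic.
rewrite /rlim; move: (some_injective_resolution F) (some_injective_resolution S) => A B.
have [sg [t [sg_io t_aug t_d]]] := twisting_maps io_inj io_p p_surj A B.
pose J := cone_resolution io_p p_surj sg_io t_aug t_d.
have pairP i (a : lim (A i)) (b : lim (B i)) :
    lim_sub (J i) (fun c => (val a c, val b c)).
  by move=> c d f; congr (_, _); [exact: (submodP a)|exact: (submodP b)].
pose pair i a b : lim (J i) := mk_submod (pairP i a b).
have cone_cocycle i a b :
    lim_map (ires_d A i) a + lim_map (t i) b = 0 -> lim_map (ires_d B i) b = 0 ->
  coboundary (fun j => lim_map (ires_d J j)) (pair i a b).
  move=> dab db; apply: K_acyclic; apply: limP => c.
  have := congr1 (fun y : lim (A i.+1) => val y c) dab.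
  have := congr1 (fun y : lim (B i.+1) => val y c) db.
  by move=> dbc dabc; apply: congr2 dabc dbc.
have tN i b : lim_map (t i.+1) (lim_map (ires_d B i) b) =
    - lim_map (ires_d A i.+1) (lim_map (t i) b).
  by apply: limP => c; exact: t_d.
have cone0 a b : lim_map (ires_d A 0) a + lim_map (t 0%N) b = 0 ->
    lim_map (ires_d B 0) b = 0 -> a = 0 /\ b = 0.
  move=> dab db; have ab0 := cone_cocycle _ _ _ dab db.
  split; apply: limP => c.
    exact: (congr1 (fun z : lim (J 0%N) => (val z c).1) ab0).
  exact: (congr1 (fun z : lim (J 0%N) => (val z c).2) ab0).
have coneS i a b : lim_map (ires_d A i.+1) a + lim_map (t i.+1) b = 0 ->
    lim_map (ires_d B i.+1) b = 0 ->
  exists a' b', lim_map (ires_d A i) a' + lim_map (t i) b' = a /\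
    lim_map (ires_d B i) b' = b.
  move=> dab db; have [y yE] := cone_cocycle _ _ _ dab db.
  exists (lim_map (rep_fst (A i) (B i)) y), (lim_map (rep_snd (A i) (B i)) y).
  split; apply: limP => c.
    exact: (congr1 (fun z : lim (J i.+1) => (val z c).1) yE).
  exact: (congr1 (fun z : lim (J i.+1) => (val z c).2) yE).
case: n => [|n]; last first.
  have -> : n.+1%:Z - 1 = n%:Z by rewrite intS addrC addKr.
  exact: cone_cohomologyS tN cone0 coneS n.
apply: lmod_iso0 => [x|y]; last by apply/rowP => -[].
  exact: (cone_cohomology0 (dX := fun i => lim_map (ires_d A i))
    (dY := fun i => lim_map (ires_d B i)) (t := fun i => lim_map (t i)) cone0).
Qed.

Theorem proposition3p1 (C : category) (cp : pairwise_coproducts C)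
    (k : comPzRingType) (F : rep k C) (hF : monoadditive cp F) (n : nat) :
  lmod_iso (rlim F n%:Z) (rlim (Sigma cp F) (n%:Z - 1)).
Proof.
have [io [p [io_inj io_p p_surj]]] := fold_ker_exact hF.
have [th thK] := fold_ker_split cp F.
apply: (lim_dimension_shift n io_inj io_p p_surj) => R i x.
exact: lim_resolution_acyclic thK.
Qed.
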